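(* Let $G$ be a set and $\alpha_G:G\to\mathbf N$ a function, and let $\mathcal{WO}_e$ and $\mathcal{WO}_u$ be the categories determined by $G$ and $\alpha_G$. For every $\mathbf N^+$-word $b$ let $\mathcal{WO}_u(b)$ be the full subcategory of $\mathcal{WO}_u$ on the objects $f$ with $t(f)=b$. Then $\mathcal{WO}_u$ is the disjoint union of its subcategories $\mathcal{WO}_u(b)$, over all $\mathbf N^+$-words $b$, and for every $\mathbf N^+$-word $b$ the category $\mathcal{WO}_u(b)$ is isomorphic to $\mathcal{WO}_e$. In other words, $\mathcal{WO}_u$ is the disjoint union of isomorphic copies of $\mathcal{WO}_e$.
   Context: **Words and nominal arities.** An $\mathbf N^+$-word is a finite (possibly empty) sequence of positive integers; $e$ is the empty word and $ab$ is the concatenation of $a$ and $b$. A nominal arity is a set of $\mathbf N^+$-words that contains no two distinct words of the form $a$ and $ab$. A word $a$ is a prefix of a nominal arity $X$ if $a$ is an initial segment (not necessarily proper) of every member of $X$; $P_X$ is the set of prefixes of $X$ (every word is a prefix of $\emptyset$). Put $a\cdot X=\{ab\mid b\in X\}$. If $a\in P_X\cap Y$, put $Y\triangleleft_a X=(Y\setminus\{a\})\cup X$, which is a nominal arity. For $n\ge 0$, $\bar n=\{1,\dots,n\}$ (one-letter words), $\bar 0=\emptyset$. **THE CATEGORY $\mathcal{WO}_e$.** *Objects.* The terms of $\mathcal O_e$ (formal expressions, not identified by any equations), defined inductively together with a nominal arity $s(f)$ for each term $f$: (0) each $x\in G$ is a term, with $s(x)=\overline{\alpha_G(x)}$ if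 $\alpha_G(x)\ne 1$ and $s(x)=\{e\}$ if $\alpha_G(x)=1$; (1) $\mathbf I$ is a term, $s(\mathbf I)=\{e\}$; (2) if $f,g$ are terms and $a\in s(g)$, then $g\triangleleft_a f$ is a term, with $s(g\triangleleft_a f)=s(g)\triangleleft_a a\cdot s(f)$. *Arrow terms.* The basic arrow terms are: - $\mathbf 1_f:f\to f$; - $\beta_{h,(b,g),(a,f)}:(h\triangleleft_b g)\triangleleft_{ba}f\to h\triangleleft_b(g\triangleleft_a f)$ and $\beta^{-1}_{h,(b,g),(a,f)}$ of the reversed type, where $b\in s(h)$, $a\in s(g)$; - $\theta_{h,(b,g),(a,f)}:(h\triangleleft_b g)\triangleleft_a f\to(h\triangleleft_a f)\triangleleft_b g$, where $a,b\in s(h)$, $a\neq b$; - $\mu_{f,a}:f\triangleleft_a\mathbf I\to f$ and $\mu^{-1}_{f,a}$ of the reversed type, where $a\in s(f)$; - $\lambda_f:\mathbf I\triangleleft_e f\to f$ and $\lambda^{-1}_f$ of the reversed type. Arrow terms are closed under composition $v\circ u$ and under insertions: if $u:f\to f'$ and $v:g\to g'$ are arrow terms and $g\triangleleft_a f$, $g'\triangleleft_a f'$ are terms, then $v\triangleleft_a u:g\triangleleft_a f\to g'\triangleleft_a f'$ is an arrow term. *Equations.* The arrows of $\mathcal{WO}_e$ are the equivalence classes of arrow terms under the smallest equivalence relation $=$ (between arrow terms of the same type) that is a congruence for $\circ$ and all $\triangleleft_a$, satisfies the category axioms (with identities $\mathbf 1_f$), and contains all instances of the following in which both sides are well-formed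 arrow terms: - $\mathbf 1_g\triangleleft_a\mathbf 1_f=\mathbf 1_{g\triangleleft_a f}$; $(v_2\circ v_1)\triangleleft_a(u_2\circ u_1)=(v_2\triangleleft_a u_2)\circ(v_1\triangleleft_a u_1)$; - for $u:f_1\to f_2$, $v:g_1\to g_2$, $w:h_1\to h_2$: $\beta_{h_2,(b,g_2),(a,f_2)}\circ((w\triangleleft_b v)\triangleleft_{ba}u)=(w\triangleleft_b(v\triangleleft_a u))\circ\beta_{h_1,(b,g_1),(a,f_1)}$ and $\theta_{h_2,(b,g_2),(a,f_2)}\circ((w\triangleleft_b v)\triangleleft_a u)=((w\triangleleft_a u)\triangleleft_b v)\circ\theta_{h_1,(b,g_1),(a,f_1)}$; - $\beta$ and $\beta^{-1}$ (with the same indices) are mutually inverse; $\theta_{h,(a,f),(b,g)}\circ\theta_{h,(b,g),(a,f)}=\mathbf 1_{(h\triangleleft_b g)\triangleleft_a f}$; - $(\mathbf 1_j\triangleleft_c\beta_{h,(b,g),(a,f)})\circ\beta_{j,(c,h\triangleleft_b g),(ba,f)}\circ(\beta_{j,(c,h),(b,g)}\triangleleft_{cba}\mathbf 1_f)=\beta_{j,(c,h),(b,g\triangleleft_a f)}\circ\beta_{j\triangleleft_c h,(cb,g),(a,f)}$; - $\theta_{j\triangleleft_a f,(c,h),(b,g)}\circ(\theta_{j,(c,h),(a,f)}\triangleleft_b\mathbf 1_g)\circ\theta_{j\triangleleft_c h,(b,g),(a,f)}=(\theta_{j,(b,g),(a,f)}\triangleleft_c\mathbf 1_h)\circ\theta_{j\triangleleft_b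 g,(c,h),(a,f)}\circ(\theta_{j,(c,h),(b,g)}\triangleleft_a\mathbf 1_f)$; - $(\mathbf 1_j\triangleleft_c\theta_{h,(b,g),(a,f)})\circ\beta_{j,(c,h\triangleleft_b g),(a,f)}\circ(\beta_{j,(c,h),(b,g)}\triangleleft_{ca}\mathbf 1_f)=\beta_{j,(c,h\triangleleft_a f),(b,g)}\circ(\beta_{j,(c,h),(a,f)}\triangleleft_{cb}\mathbf 1_g)\circ\theta_{j\triangleleft_c h,(cb,g),(ca,f)}$; - $\theta_{j,(c,h\triangleleft_b g),(a,f)}\circ(\beta_{j,(c,h),(b,g)}\triangleleft_a\mathbf 1_f)=\beta_{j\triangleleft_a f,(c,h),(b,g)}\circ(\theta_{j,(c,h),(a,f)}\triangleleft_{cb}\mathbf 1_g)\circ\theta_{j\triangleleft_c h,(cb,g),(a,f)}$; - for $u:f_1\to f_2$: $\mu_{f_2,a}\circ(u\triangleleft_a\mathbf 1_{\mathbf I})=u\circ\mu_{f_1,a}$ and $\lambda_{f_2}\circ(\mathbf 1_{\mathbf I}\triangleleft_e u)=u\circ\lambda_{f_1}$; $\mu,\mu^{-1}$ and $\lambda,\lambda^{-1}$ (with the same indices) are mutually inverse; - $\beta_{h,(b,\mathbf I),(e,f)}=(\mathbf 1_h\triangleleft_b\lambda^{-1}_f)\circ(\mu_{h,b}\triangleleft_b\mathbf 1_f)$; $\theta_{h,(b,\mathbf I),(a,f)}=\mu^{-1}_{h\triangleleft_a f,b}\circ(\mu_{h,b}\triangleleft_a\mathbf 1_f)$. **THE CATEGORY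 $\mathcal{WO}_u$.** *Objects.* The terms of $\mathcal O_u$ (formal expressions, not identified by any equations), defined inductively together with a nominal arity $s(f)$ and an $\mathbf N^+$-word $t(f)$ for each term $f$: (0) for $x\in G$ and a word $a$, $a\cdot x$ is a term, with $s(a\cdot x)=a\cdot\overline{\alpha_G(x)}$ if $\alpha_G(x)\neq1$, $s(a\cdot x)=\{a\}$ if $\alpha_G(x)=1$, and $t(a\cdot x)=a$; (1) for a word $a$, $a\cdot\mathbf I$ is a term, $s(a\cdot\mathbf I)=\{a\}$, $t(a\cdot\mathbf I)=a$; (2) if $f,g$ are terms and $t(f)\in s(g)$, then $g\triangleleft f$ is a term, $s(g\triangleleft f)=s(g)\triangleleft_{t(f)}s(f)$, $t(g\triangleleft f)=t(g)$. (One always has $t(f)\in P_{s(f)}$.) *Arrow terms.* The basic arrow terms are: - $\mathbf 1_f:f\to f$; - $\beta_{h,g,f}:(h\triangleleft g)\triangleleft f\to h\triangleleft(g\triangleleft f)$ and $\beta^{-1}_{h,g,f}$ of the reversed type, where $t(g)\in s(h)$, $t(f)\in s(g)$; - $\theta_{h,g,f}:(h\triangleleft g)\triangleleft f\to(h\triangleleft f)\triangleleft g$, where $t(g),t(f)\in s(h)$, $t(g)\ne t(f)$; - $\mu_{f,a}:f\triangleleft a\cdot\mathbf I\to f$ and $\mu^{-1}_{f,a}$ of the reversed type, where $a\in s(f)$; - $\lambda_f:t(f)\cdot\mathbf I\triangleleft f\to f$ and $\lambda^{-1}_f$ of the reversed type. Arrow terms are closed under composition $v\circ u$ and under insertion: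 if $u:f\to f'$ and $v:g\to g'$ are arrow terms and $g\triangleleft f$, $g'\triangleleft f'$ are terms, then $v\triangleleft u:g\triangleleft f\to g'\triangleleft f'$ is an arrow term. *Equations.* The arrows of $\mathcal{WO}_u$ are the equivalence classes of arrow terms under the smallest equivalence relation $=$ (between arrow terms of the same type) that is a congruence for $\circ$ and $\triangleleft$, satisfies the category axioms (with identities $\mathbf 1_f$), and contains all instances of the following in which both sides are well-formed arrow terms: - $\mathbf 1_g\triangleleft\mathbf 1_f=\mathbf 1_{g\triangleleft f}$; $(v_2\circ v_1)\triangleleft(u_2\circ u_1)=(v_2\triangleleft u_2)\circ(v_1\triangleleft u_1)$; - for $u:f_1\to f_2$, $v:g_1\to g_2$, $w:h_1\to h_2$: $\beta_{h_2,g_2,f_2}\circ((w\triangleleft v)\triangleleft u)=(w\triangleleft(v\triangleleft u))\circ\beta_{h_1,g_1,f_1}$ and $\theta_{h_2,g_2,f_2}\circ((w\triangleleft v)\triangleleft u)=((w\triangleleft u)\triangleleft v)\circ\theta_{h_1,g_1,f_1}$; - $\beta_{h,g,f}$ and $\beta^{-1}_{h,g,f}$ are mutually inverse; $\theta_{h,f,g}\circ\theta_{h,g,f}=\mathbf 1_{(h\triangleleft g)\triangleleft f}$; - $(\mathbf 1_j\triangleleft\beta_{h,g,f})\circ\beta_{j,h\triangleleft g,f}\circ(\beta_{j,h,g}\triangleleft\mathbf 1_f)=\beta_{j,h,g\triangleleft f}\circ\beta_{j\triangleleft h,g,f}$; - $\theta_{j\triangleleft f,h,g}\circ(\theta_{j,h,f}\triangleleft\mathbf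 1_g)\circ\theta_{j\triangleleft h,g,f}=(\theta_{j,g,f}\triangleleft\mathbf 1_h)\circ\theta_{j\triangleleft g,h,f}\circ(\theta_{j,h,g}\triangleleft\mathbf 1_f)$; - $(\mathbf 1_j\triangleleft\theta_{h,g,f})\circ\beta_{j,h\triangleleft g,f}\circ(\beta_{j,h,g}\triangleleft\mathbf 1_f)=\beta_{j,h\triangleleft f,g}\circ(\beta_{j,h,f}\triangleleft\mathbf 1_g)\circ\theta_{j\triangleleft h,g,f}$; - $\theta_{j,h\triangleleft g,f}\circ(\beta_{j,h,g}\triangleleft\mathbf 1_f)=\beta_{j\triangleleft f,h,g}\circ(\theta_{j,h,f}\triangleleft\mathbf 1_g)\circ\theta_{j\triangleleft h,g,f}$; - for $u:f_1\to f_2$: $\mu_{f_2,a}\circ(u\triangleleft\mathbf 1_{a\cdot\mathbf I})=u\circ\mu_{f_1,a}$ and $\lambda_{f_2}\circ(\mathbf 1_{t(f_1)\cdot\mathbf I}\triangleleft u)=u\circ\lambda_{f_1}$; $\mu,\mu^{-1}$ and $\lambda,\lambda^{-1}$ (with the same indices) are mutually inverse; - $\beta_{h,t(f)\cdot\mathbf I,f}=(\mathbf 1_h\triangleleft\lambda^{-1}_f)\circ(\mu_{h,t(f)}\triangleleft\mathbf 1_f)$; $\theta_{h,b\cdot\mathbf I,f}=\mu^{-1}_{h\triangleleft f,b}\circ(\mu_{h,b}\triangleleft\mathbf 1_f)$. *)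

(* Defs.v *)
From mathcomp Require Import all_boot.
From mathcomp Require Import boolp classical_sets.

Set Implicit Arguments.
Unset Strict Implicit.
Unset Printing Implicit Defensive.

Local Open Scope classical_set_scope.
Local Open Scope quotient_scope.

(* Hom-types are compared with Leibniz equality, so that functors can be
   compared with Leibniz equality as well and isomorphism of categories is the
   strict notion. *)
Record category := Category {
  ob :> Type;
  hom : ob -> ob -> Type;
  idc : forall x, hom x x;
  compc : forall x y z, hom y z -> hom x y -> hom x z;
  compc1 : forall x y (u : hom x y), compc u (idc x) = u;
  comp1c : forall x y (u : hom x y), compc (idc y) u = u;
  compcA : forall x y z t (w : hom z t) (v : hom y z) (u : hom x y),
    compc w (compc v u) = compc (compc w v) u }.
Arguments idc {c} x.

Record functor (C D : category) := Functor {
  fob :> C -> D;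
  fhom : forall x y, hom x y -> hom (fob x) (fob y);
  fhom1 : forall x, fhom (idc x) = idc (fob x);
  fhomM : forall x y z (v : hom y z) (u : hom x y),
    fhom (compc v u) = compc (fhom v) (fhom u) }.

Definition functor_id (C : category) : functor C C :=
  @Functor C C id (fun x y u => u)
    (fun x => erefl) (fun x y z v u => erefl).

Lemma functor_comp1 (C D E : category) (T : functor D E) (S : functor C D) x :
  fhom T (fhom S (idc x)) = idc (T (S x)).
Proof. by rewrite !fhom1. Qed.

Lemma functor_compM (C D E : category) (T : functor D E) (S : functor C D)
  x y z (v : hom y z) (u : hom x y) :
  fhom T (fhom S (compc v u)) =
  compc (fhom T (fhom S v)) (fhom T (fhom S u)).
Proof. by rewrite !fhomM. Qed.

Definition functor_comp (C D E : category) (T : functor D E) (S : functor C D)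
  : functor C E :=
  @Functor C E (fun x => T (S x)) (fun x y u => fhom T (fhom S u))
    (functor_comp1 T S) (functor_compM T S).

Definition isomorphic (C D : category) : Prop :=
  exists (S : functor C D) (T : functor D C),
    functor_comp T S = functor_id C /\ functor_comp S T = functor_id D.

Record subcategory (C : category) := Subcategory {
  sub_ob : C -> Prop;
  sub_hom : forall x y : C, hom x y -> Prop;
  sub_source : forall (x y : C) (u : hom x y), sub_hom u -> sub_ob x;
  sub_target : forall (x y : C) (u : hom x y), sub_hom u -> sub_ob y;
  sub_idc : forall x, sub_ob x -> sub_hom (idc x);
  sub_compc : forall (x y z : C) (v : hom y z) (u : hom x y),
    sub_hom v -> sub_hom u -> sub_hom (compc v u) }.

Definition full_subcategory (C : category) (P : C -> Prop) : subcategory C :=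
  @Subcategory C P (fun x y _ => P x /\ P y)
    (fun x y u => @proj1 _ _) (fun x y u => @proj2 _ _)
    (fun x Px => conj Px Px)
    (fun x y z v u Pv Pu => conj (proj1 Pu) (proj2 Pv)).

Section CategoryOfSubcategory.
Variables (C : category) (S : subcategory C).

Definition subcat_ob := {x : C | sub_ob S x}.
Definition subcat_hom (x y : subcat_ob) :=
  {u : hom (sval x) (sval y) | sub_hom S u}.
Definition subcat_id (x : subcat_ob) : subcat_hom x x :=
  exist _ (idc (sval x)) (sub_idc (svalP x)).
Definition subcat_comp (x y z : subcat_ob)
    (v : subcat_hom y z) (u : subcat_hom x y) : subcat_hom x z :=
  exist _ (compc (sval v) (sval u)) (sub_compc (svalP v) (svalP u)).

Lemma subcat_comp1 x y (u : subcat_hom x y) : subcat_comp u (subcat_id x) = u.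
Proof. by case: u => u Su; apply: eq_exist; rewrite /= compc1. Qed.

Lemma subcat_1comp x y (u : subcat_hom x y) : subcat_comp (subcat_id y) u = u.
Proof. by case: u => u Su; apply: eq_exist; rewrite /= comp1c. Qed.

Lemma subcat_compA x y z t
    (w : subcat_hom z t) (v : subcat_hom y z) (u : subcat_hom x y) :
  subcat_comp w (subcat_comp v u) = subcat_comp (subcat_comp w v) u.
Proof. by apply: eq_exist; rewrite /= compcA. Qed.

Definition category_of_subcategory : category :=
  Category subcat_comp1 subcat_1comp subcat_compA.

End CategoryOfSubcategory.

(* Both the set of objects and the set of arrows of [C] are the disjoint
   unions of those of the subcategories. *)
Definition disjoint_union_of_subcategories
    (C : category) (I : Type) (S : I -> subcategory C) : Prop :=
  (forall x : C, exists! i, sub_ob (S i) x) /\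
  (forall (x y : C) (u : hom x y), exists! i, sub_hom (S i) u).

Record precategory := Precategory {
  pob : Type;
  phom : pob -> pob -> Type;
  pid : forall x, phom x x;
  pcomp : forall x y z, phom y z -> phom x y -> phom x z;
  peq : forall x y, phom x y -> phom x y -> Prop;
  peq_refl : forall x y (u : phom x y), peq u u;
  peq_sym : forall x y (u v : phom x y), peq u v -> peq v u;
  peq_trans : forall x y (u v w : phom x y), peq u v -> peq v w -> peq u w;
  peq_comp : forall x y z (v v' : phom y z) (u u' : phom x y),
    peq v v' -> peq u u' -> peq (pcomp v u) (pcomp v' u');
  pcomp1 : forall x y (u : phom x y), peq (pcomp u (pid x)) u;
  p1comp : forall x y (u : phom x y), peq (pcomp (pid y) u) u;
  pcompA : forall x y z t (w : phom z t) (v : phom y z) (u : phom x y),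
    peq (pcomp w (pcomp v u)) (pcomp (pcomp w v) u) }.

Section QuotientCategory.
Variable P : precategory.
Implicit Types x y z t : pob P.

Definition peqb x y (u v : {classic (phom x y)}) : bool := `[< peq u v >].

Lemma peqb_refl x y : reflexive (@peqb x y).
Proof. by move=> u; apply/asboolP/peq_refl. Qed.

Lemma peqb_sym x y : symmetric (@peqb x y).
Proof. by move=> u v; apply/asboolP/asboolP; apply: peq_sym. Qed.

Lemma peqb_trans x y : transitive (@peqb x y).
Proof.
by move=> v u w /asboolP uv /asboolP vw; apply/asboolP/(peq_trans uv vw).
Qed.

Definition peq_equiv x y : equiv_rel {classic (phom x y)} :=
  EquivRel (@peqb x y) (@peqb_refl x y) (@peqb_sym x y) (@peqb_trans x y).

Definition qhom x y : Type := {eq_quot (peq_equiv x y)}.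

Definition qclass x y (u : phom x y) : qhom x y :=
  \pi_({eq_quot (peq_equiv x y)}) (u : {classic (phom x y)}).

Definition qrepr x y (A : qhom x y) : phom x y :=
  repr (A : {eq_quot (peq_equiv x y)}).

Definition qid x : qhom x x := qclass (pid x).
Definition qcomp x y z (B : qhom y z) (A : qhom x y) : qhom x z :=
  qclass (pcomp (qrepr B) (qrepr A)).

Lemma qclassP x y (u v : phom x y) : qclass u = qclass v <-> peq u v.
Proof.
by split=> [/eqmodP/asboolP|uv] //; apply/eqmodP/asboolP.
Qed.

Lemma qreprK x y (A : qhom x y) : qclass (qrepr A) = A.
Proof. by rewrite /qclass /qrepr reprK. Qed.

Lemma qrepr_class x y (u : phom x y) : peq (qrepr (qclass u)) u.
Proof. by apply/qclassP; rewrite qreprK. Qed.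

Lemma qcompE x y z (v : phom y z) (u : phom x y) :
  qcomp (qclass v) (qclass u) = qclass (pcomp v u).
Proof. by apply/qclassP/peq_comp; apply: qrepr_class. Qed.

Lemma qcomp1 x y (A : qhom x y) : qcomp A (qid x) = A.
Proof. by rewrite -(qreprK A) qcompE; apply/qclassP/pcomp1. Qed.

Lemma q1comp x y (A : qhom x y) : qcomp (qid y) A = A.
Proof. by rewrite -(qreprK A) qcompE; apply/qclassP/p1comp. Qed.

Lemma qcompA x y z t (E : qhom z t) (B : qhom y z) (A : qhom x y) :
  qcomp E (qcomp B A) = qcomp (qcomp E B) A.
Proof.
rewrite -(qreprK A) -(qreprK B) -(qreprK E) !qcompE.
by apply/qclassP/pcompA.
Qed.

Definition quotient_category : category := Category qcomp1 q1comp qcompA.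

End QuotientCategory.

Definition Nplus := {n : nat | 0 < n}.
Definition word := seq Nplus.

Definition bar (n : nat) : set word :=
  [set [:: i] | i in [set i : Nplus | sval i <= n]].

Definition cat_set (a : word) (X : set word) : set word :=
  [set a ++ b | b in X].

(* [Y <|_a X]; only meaningful for [a \in Y] a prefix of [X], which holds
   wherever it is used on well-formed terms. *)
Definition insert_set (Y : set word) (a : word) (X : set word) : set word :=
  (Y `\ a) `|` X.

(* Terms and arrow terms are given by raw syntax together with a
   well-formedness predicate (resp. a typing relation).  This keeps the
   equations free of casts along [(c ++ b) ++ a = c ++ (b ++ a)] and
   [b ++ [::] = b]. *)
Module WOe.
Section Defs.
Variables (G : Type) (alpha : G -> nat).

Inductive term : Type :=
| Gen of G
| Unit
| Ins of term & word & term.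

Fixpoint s (f : term) : set word :=
  match f with
  | Gen x => if alpha x != 1 then bar (alpha x) else [set [::]]
  | Unit => [set [::]]
  | Ins g a f => insert_set (s g) a (cat_set a (s f))
  end.

Fixpoint wf (f : term) : Prop :=
  match f with
  | Gen _ | Unit => True
  | Ins g a f => [/\ wf g, wf f & s g a]
  end.

Inductive arr : Type :=
| One of term
| Beta of term & word & term & word & term
| BetaV of term & word & term & word & term
| Theta of term & word & term & word & term
| Mu of term & word
| MuV of term & word
| Lam of term
| LamV of term
| Comp of arr & arr
| AIns of arr & word & arr.

Declare Scope e_term_scope.
Declare Scope e_arr_scope.
Bind Scope e_term_scope with term.
Bind Scope e_arr_scope with arr.
Local Notation "g <|[ a ] f" := (Ins g a f)
  (at level 40, left associativity) : e_term_scope.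
Local Notation "v <|[ a ] u" := (AIns v a u)
  (at level 40, left associativity) : e_arr_scope.
Local Notation "v \o u" := (Comp v u) : e_arr_scope.

Inductive typed : arr -> term -> term -> Prop :=
| typed_One f : wf f -> typed (One f) f f
| typed_Beta h b g a f : wf h -> wf g -> wf f -> s h b -> s g a ->
    typed (Beta h b g a f)
      ((h <|[b] g) <|[b ++ a] f) (h <|[b] (g <|[a] f))
| typed_BetaV h b g a f : wf h -> wf g -> wf f -> s h b -> s g a ->
    typed (BetaV h b g a f)
      (h <|[b] (g <|[a] f)) ((h <|[b] g) <|[b ++ a] f)
| typed_Theta h b g a f :
    wf h -> wf g -> wf f -> s h a -> s h b -> a <> b ->
    typed (Theta h b g a f)
      ((h <|[b] g) <|[a] f) ((h <|[a] f) <|[b] g)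
| typed_Mu f a : wf f -> s f a -> typed (Mu f a) (f <|[a] Unit) f
| typed_MuV f a : wf f -> s f a -> typed (MuV f a) f (f <|[a] Unit)
| typed_Lam f : wf f -> typed (Lam f) (Unit <|[ [::] ] f) f
| typed_LamV f : wf f -> typed (LamV f) f (Unit <|[ [::] ] f)
| typed_Comp u v f g h :
    typed u f g -> typed v g h -> typed (v \o u) f h
| typed_Ins u v a f f' g g' :
    typed u f f' -> typed v g g' ->
    wf (g <|[a] f) -> wf (g' <|[a] f') ->
    typed (v <|[a] u) (g <|[a] f) (g' <|[a] f').

(* The generating equations; [eqv_ax] restricts them to the instances whose
   two sides are arrow terms of the same type. *)
Inductive ax : arr -> arr -> Prop :=
| ax_comp1 u f g : typed u f g -> ax (u \o One f) u
| ax_1comp u f g : typed u f g -> ax (One g \o u) u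
| ax_compA u v w : ax (w \o (v \o u)) ((w \o v) \o u)
| ax_ins1 g a f : ax (One g <|[a] One f) (One (g <|[a] f))
| ax_ins_comp v1 v2 a u1 u2 :
    ax ((v2 \o v1) <|[a] (u2 \o u1)) ((v2 <|[a] u2) \o (v1 <|[a] u1))
| ax_Beta_nat u v w f1 f2 g1 g2 h1 h2 a b :
    typed u f1 f2 -> typed v g1 g2 -> typed w h1 h2 ->
    ax (Beta h2 b g2 a f2 \o ((w <|[b] v) <|[b ++ a] u))
       ((w <|[b] (v <|[a] u)) \o Beta h1 b g1 a f1)
| ax_Theta_nat u v w f1 f2 g1 g2 h1 h2 a b :
    typed u f1 f2 -> typed v g1 g2 -> typed w h1 h2 ->
    ax (Theta h2 b g2 a f2 \o ((w <|[b] v) <|[a] u))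
       (((w <|[a] u) <|[b] v) \o Theta h1 b g1 a f1)
| ax_BetaK h b g a f :
    ax (BetaV h b g a f \o Beta h b g a f)
       (One ((h <|[b] g) <|[b ++ a] f))
| ax_BetaVK h b g a f :
    ax (Beta h b g a f \o BetaV h b g a f)
       (One (h <|[b] (g <|[a] f)))
| ax_ThetaK h b g a f :
    ax (Theta h a f b g \o Theta h b g a f)
       (One ((h <|[b] g) <|[a] f))
| ax_BetaBeta j c h b g a f :
    ax ((One j <|[c] Beta h b g a f)
          \o Beta j c (h <|[b] g) (b ++ a) f
          \o (Beta j c h b g <|[c ++ b ++ a] One f))
       (Beta j c h b (g <|[a] f)
          \o Beta (j <|[c] h) (c ++ b) g a f)
| ax_ThetaTheta j c h b g a f :
    ax (Theta (j <|[a] f) c h b g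
          \o (Theta j c h a f <|[b] One g)
          \o Theta (j <|[c] h) b g a f)
       ((Theta j b g a f <|[c] One h)
          \o Theta (j <|[b] g) c h a f
          \o (Theta j c h b g <|[a] One f))
| ax_BetaTheta1 j c h b g a f :
    ax ((One j <|[c] Theta h b g a f)
          \o Beta j c (h <|[b] g) a f
          \o (Beta j c h b g <|[c ++ a] One f))
       (Beta j c (h <|[a] f) b g
          \o (Beta j c h a f <|[c ++ b] One g)
          \o Theta (j <|[c] h) (c ++ b) g (c ++ a) f)
| ax_BetaTheta2 j c h b g a f :
    ax (Theta j c (h <|[b] g) a f
          \o (Beta j c h b g <|[a] One f))
       (Beta (j <|[a] f) c h b g
          \o (Theta j c h a f <|[c ++ b] One g)
          \o Theta (j <|[c] h) (c ++ b) g a f)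
| ax_Mu_nat u f1 f2 a : typed u f1 f2 ->
    ax (Mu f2 a \o (u <|[a] One Unit)) (u \o Mu f1 a)
| ax_Lam_nat u f1 f2 : typed u f1 f2 ->
    ax (Lam f2 \o (One Unit <|[ [::] ] u)) (u \o Lam f1)
| ax_MuK f a : ax (MuV f a \o Mu f a) (One (f <|[a] Unit))
| ax_MuVK f a : ax (Mu f a \o MuV f a) (One f)
| ax_LamK f : ax (LamV f \o Lam f) (One (Unit <|[ [::] ] f))
| ax_LamVK f : ax (Lam f \o LamV f) (One f)
| ax_BetaUnit h b f :
    ax (Beta h b Unit [::] f)
       ((One h <|[b] LamV f) \o (Mu h b <|[b] One f))
| ax_ThetaUnit h b a f :
    ax (Theta h b Unit a f)
       (MuV (h <|[a] f) b \o (Mu h b <|[a] One f)).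

Inductive eqv : term -> term -> arr -> arr -> Prop :=
| eqv_ax f g u v : ax u v -> typed u f g -> typed v f g -> eqv f g u v
| eqv_refl f g u : typed u f g -> eqv f g u u
| eqv_sym f g u v : eqv f g u v -> eqv f g v u
| eqv_trans f g u v w : eqv f g u v -> eqv f g v w -> eqv f g u w
| eqv_Comp f g h u u' v v' :
    eqv f g u u' -> eqv g h v v' -> eqv f h (v \o u) (v' \o u')
| eqv_Ins a f f' g g' u u' v v' :
    eqv f f' u u' -> eqv g g' v v' ->
    wf (g <|[a] f) -> wf (g' <|[a] f') ->
    eqv (g <|[a] f) (g' <|[a] f') (v <|[a] u) (v' <|[a] u').

Definition Ob := {f : term | wf f}.
Definition Arr (f g : Ob) := {u : arr | typed u (sval f) (sval g)}.
Definition id_Arr (f : Ob) : Arr f f :=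
  exist _ (One (sval f)) (typed_One (svalP f)).
Definition comp_Arr (f g h : Ob) (v : Arr g h) (u : Arr f g) : Arr f h :=
  exist _ (Comp (sval v) (sval u)) (typed_Comp (svalP u) (svalP v)).
Definition eq_Arr (f g : Ob) (u v : Arr f g) : Prop :=
  eqv (sval f) (sval g) (sval u) (sval v).

Lemma eq_Arr_comp1 (f g : Ob) (u : Arr f g) :
  eq_Arr (comp_Arr u (id_Arr f)) u.
Proof.
apply: eqv_ax (ax_comp1 (svalP u)) _ (svalP u).
exact: svalP (comp_Arr u (id_Arr f)).
Qed.

Lemma eq_Arr_1comp (f g : Ob) (u : Arr f g) :
  eq_Arr (comp_Arr (id_Arr g) u) u.
Proof.
apply: eqv_ax (ax_1comp (svalP u)) _ (svalP u).
exact: svalP (comp_Arr (id_Arr g) u).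
Qed.

Lemma eq_Arr_compA (f g h k : Ob) (w : Arr h k) (v : Arr g h) (u : Arr f g) :
  eq_Arr (comp_Arr w (comp_Arr v u)) (comp_Arr (comp_Arr w v) u).
Proof.
apply: eqv_ax (ax_compA _ _ _) _ _.
- exact: svalP (comp_Arr w (comp_Arr v u)).
- exact: svalP (comp_Arr (comp_Arr w v) u).
Qed.

Definition presentation : precategory :=
  @Precategory Ob Arr id_Arr comp_Arr eq_Arr
    (fun f g u => eqv_refl (svalP u))
    (fun f g u v => @eqv_sym _ _ _ _)
    (fun f g u v w => @eqv_trans _ _ _ _ _)
    (fun f g h v v' u u' ev eu => eqv_Comp eu ev)
    eq_Arr_comp1 eq_Arr_1comp eq_Arr_compA.

Definition cat : category := quotient_category presentation.

End Defs.
End WOe.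

Module WOu.
Section Defs.
Variables (G : Type) (alpha : G -> nat).

Inductive term : Type :=
| Gen of word & G
| Unit of word
| Ins of term & term.

Fixpoint t (f : term) : word :=
  match f with
  | Gen a _ => a
  | Unit a => a
  | Ins g _ => t g
  end.

Fixpoint s (f : term) : set word :=
  match f with
  | Gen a x => if alpha x != 1 then cat_set a (bar (alpha x)) else [set a]
  | Unit a => [set a]
  | Ins g f => insert_set (s g) (t f) (s f)
  end.

Fixpoint wf (f : term) : Prop :=
  match f with
  | Gen _ _ | Unit _ => True
  | Ins g f => [/\ wf g, wf f & s g (t f)]
  end.

Inductive arr : Type :=
| One of term
| Beta of term & term & term
| BetaV of term & term & term
| Theta of term & term & term
| Mu of term & word
| MuV of term & word
| Lam of term
| LamV of term
| Comp of arr & arr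
| AIns of arr & arr.

Declare Scope u_term_scope.
Declare Scope u_arr_scope.
Bind Scope u_term_scope with term.
Bind Scope u_arr_scope with arr.
Local Notation "g <| f" := (Ins g f)
  (at level 40, left associativity) : u_term_scope.
Local Notation "v <| u" := (AIns v u)
  (at level 40, left associativity) : u_arr_scope.
Local Notation "v \o u" := (Comp v u) : u_arr_scope.

Inductive typed : arr -> term -> term -> Prop :=
| typed_One f : wf f -> typed (One f) f f
| typed_Beta h g f : wf h -> wf g -> wf f -> s h (t g) -> s g (t f) ->
    typed (Beta h g f) ((h <| g) <| f) (h <| (g <| f))
| typed_BetaV h g f : wf h -> wf g -> wf f -> s h (t g) -> s g (t f) ->
    typed (BetaV h g f) (h <| (g <| f)) ((h <| g) <| f)
| typed_Theta h g f :
    wf h -> wf g -> wf f -> s h (t g) -> s h (t f) -> t g <> t f ->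
    typed (Theta h g f) ((h <| g) <| f) ((h <| f) <| g)
| typed_Mu f a : wf f -> s f a -> typed (Mu f a) (f <| Unit a) f
| typed_MuV f a : wf f -> s f a -> typed (MuV f a) f (f <| Unit a)
| typed_Lam f : wf f -> typed (Lam f) (Unit (t f) <| f) f
| typed_LamV f : wf f -> typed (LamV f) f (Unit (t f) <| f)
| typed_Comp u v f g h :
    typed u f g -> typed v g h -> typed (v \o u) f h
| typed_Ins u v f f' g g' :
    typed u f f' -> typed v g g' ->
    wf (g <| f) -> wf (g' <| f') ->
    typed (v <| u) (g <| f) (g' <| f').

Inductive ax : arr -> arr -> Prop :=
| ax_comp1 u f g : typed u f g -> ax (u \o One f) u
| ax_1comp u f g : typed u f g -> ax (One g \o u) u
| ax_compA u v w : ax (w \o (v \o u)) ((w \o v) \o u)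
| ax_ins1 g f : ax (One g <| One f) (One (g <| f))
| ax_ins_comp v1 v2 u1 u2 :
    ax ((v2 \o v1) <| (u2 \o u1)) ((v2 <| u2) \o (v1 <| u1))
| ax_Beta_nat u v w f1 f2 g1 g2 h1 h2 :
    typed u f1 f2 -> typed v g1 g2 -> typed w h1 h2 ->
    ax (Beta h2 g2 f2 \o ((w <| v) <| u))
       ((w <| (v <| u)) \o Beta h1 g1 f1)
| ax_Theta_nat u v w f1 f2 g1 g2 h1 h2 :
    typed u f1 f2 -> typed v g1 g2 -> typed w h1 h2 ->
    ax (Theta h2 g2 f2 \o ((w <| v) <| u))
       (((w <| u) <| v) \o Theta h1 g1 f1)
| ax_BetaK h g f :
    ax (BetaV h g f \o Beta h g f) (One ((h <| g) <| f))
| ax_BetaVK h g f :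
    ax (Beta h g f \o BetaV h g f) (One (h <| (g <| f)))
| ax_ThetaK h g f :
    ax (Theta h f g \o Theta h g f) (One ((h <| g) <| f))
| ax_BetaBeta j h g f :
    ax ((One j <| Beta h g f)
          \o Beta j (h <| g) f
          \o (Beta j h g <| One f))
       (Beta j h (g <| f) \o Beta (j <| h) g f)
| ax_ThetaTheta j h g f :
    ax (Theta (j <| f) h g
          \o (Theta j h f <| One g)
          \o Theta (j <| h) g f)
       ((Theta j g f <| One h)
          \o Theta (j <| g) h f
          \o (Theta j h g <| One f))
| ax_BetaTheta1 j h g f :
    ax ((One j <| Theta h g f)
          \o Beta j (h <| g) f
          \o (Beta j h g <| One f))
       (Beta j (h <| f) g
          \o (Beta j h f <| One g)
          \o Theta (j <| h) g f)
| ax_BetaTheta2 j h g f :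
    ax (Theta j (h <| g) f
          \o (Beta j h g <| One f))
       (Beta (j <| f) h g
          \o (Theta j h f <| One g)
          \o Theta (j <| h) g f)
| ax_Mu_nat u f1 f2 a : typed u f1 f2 ->
    ax (Mu f2 a \o (u <| One (Unit a))) (u \o Mu f1 a)
| ax_Lam_nat u f1 f2 : typed u f1 f2 ->
    ax (Lam f2 \o (One (Unit (t f1)) <| u)) (u \o Lam f1)
| ax_MuK f a : ax (MuV f a \o Mu f a) (One (f <| Unit a))
| ax_MuVK f a : ax (Mu f a \o MuV f a) (One f)
| ax_LamK f : ax (LamV f \o Lam f) (One (Unit (t f) <| f))
| ax_LamVK f : ax (Lam f \o LamV f) (One f)
| ax_BetaUnit h f :
    ax (Beta h (Unit (t f)) f)
       ((One h <| LamV f) \o (Mu h (t f) <| One f))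
| ax_ThetaUnit h b f :
    ax (Theta h (Unit b) f)
       (MuV (h <| f) b \o (Mu h b <| One f)).

Inductive eqv : term -> term -> arr -> arr -> Prop :=
| eqv_ax f g u v : ax u v -> typed u f g -> typed v f g -> eqv f g u v
| eqv_refl f g u : typed u f g -> eqv f g u u
| eqv_sym f g u v : eqv f g u v -> eqv f g v u
| eqv_trans f g u v w : eqv f g u v -> eqv f g v w -> eqv f g u w
| eqv_Comp f g h u u' v v' :
    eqv f g u u' -> eqv g h v v' -> eqv f h (v \o u) (v' \o u')
| eqv_Ins f f' g g' u u' v v' :
    eqv f f' u u' -> eqv g g' v v' ->
    wf (g <| f) -> wf (g' <| f') ->
    eqv (g <| f) (g' <| f') (v <| u) (v' <| u').

Definition Ob := {f : term | wf f}.
Definition Arr (f g : Ob) := {u : arr | typed u (sval f) (sval g)}.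
Definition id_Arr (f : Ob) : Arr f f :=
  exist _ (One (sval f)) (typed_One (svalP f)).
Definition comp_Arr (f g h : Ob) (v : Arr g h) (u : Arr f g) : Arr f h :=
  exist _ (Comp (sval v) (sval u)) (typed_Comp (svalP u) (svalP v)).
Definition eq_Arr (f g : Ob) (u v : Arr f g) : Prop :=
  eqv (sval f) (sval g) (sval u) (sval v).

Lemma eq_Arr_comp1 (f g : Ob) (u : Arr f g) :
  eq_Arr (comp_Arr u (id_Arr f)) u.
Proof.
apply: eqv_ax (ax_comp1 (svalP u)) _ (svalP u).
exact: svalP (comp_Arr u (id_Arr f)).
Qed.

Lemma eq_Arr_1comp (f g : Ob) (u : Arr f g) :
  eq_Arr (comp_Arr (id_Arr g) u) u.
Proof.
apply: eqv_ax (ax_1comp (svalP u)) _ (svalP u).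
exact: svalP (comp_Arr (id_Arr g) u).
Qed.

Lemma eq_Arr_compA (f g h k : Ob) (w : Arr h k) (v : Arr g h) (u : Arr f g) :
  eq_Arr (comp_Arr w (comp_Arr v u)) (comp_Arr (comp_Arr w v) u).
Proof.
apply: eqv_ax (ax_compA _ _ _) _ _.
- exact: svalP (comp_Arr w (comp_Arr v u)).
- exact: svalP (comp_Arr (comp_Arr w v) u).
Qed.

Definition presentation : precategory :=
  @Precategory Ob Arr id_Arr comp_Arr eq_Arr
    (fun f g u => eqv_refl (svalP u))
    (fun f g u v => @eqv_sym _ _ _ _)
    (fun f g u v w => @eqv_trans _ _ _ _ _)
    (fun f g h v v' u u' ev eu => eqv_Comp eu ev)
    eq_Arr_comp1 eq_Arr_1comp eq_Arr_compA.

Definition cat : category := quotient_category presentation.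

Definition cat_at (b : word) : subcategory cat :=
  full_subcategory (fun f : cat => t (sval f) = b).

End Defs.
End WOu.

(* Main.v *)
From mathcomp Require Import all_boot.
From mathcomp Require Import boolp classical_sets.
Require Import Defs.

(** In a term of [WOu] every leaf carries an absolute address, and the root
    word [t f] is a prefix of every word of [s f]; in a term of [WOe] the
    insertion [g <|[a] f] records only the address [a] of [f] relative to
    [g].  Fixing the address [b] of the root therefore makes the two kinds of
    term interchangeable.  [place b] pushes [b] down a term of [WOe],
    replacing relative addresses by absolute ones; [unplace] replaces the
    absolute address [t f] of an inserted term by what remains of it after
    deleting the prefix [t g].  Since [s (place b f) = b . s f] ([s_place]),
    both maps preserve well-formedness, and they are mutually inverse between
    terms of [WOe] and terms of [WOu] rooted at [b] ([placeK], [unplaceK]).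

    The same recipe applies to arrow terms, because the two ends of a typed
    arrow term of [WOu] have the same root ([typed_root]).  This fact also
    shows that there are no arrows between different [WOu(b)], whence the
    disjoint union.  The translations preserve typing and send each
    generating equation to the corresponding one ([ax_place], [ax_unplace]),
    so they induce functors between the quotient categories.  These functors
    are mutually inverse because the translations already are inverse on the
    syntax, before equations are imposed ([placeK], [place_arrK], [unplaceK],
    [unplace_arrK]). *)

Set Implicit Arguments.
Unset Strict Implicit.
Unset Printing Implicit Defensive.

Local Open Scope classical_set_scope.

(** * Functors between subcategories and quotient categories *)

(** An arrow bundled with its endpoints: arrows whose endpoints are only
    propositionally equal can be compared by Leibniz equality, without
    casts. *)
Definition total_hom (C : category) (x y : C) (u : hom x y) :
  {p : C * C & hom p.1 p.2} := existT (fun p => hom p.1 p.2) (x, y) u.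

Lemma total_hom_inj (C : category) (x y : C) (u v : hom x y) :
  total_hom u = total_hom v -> u = v.
Proof.
move=> E; have := projT2_eq E.
by rewrite (Prop_irrelevance (projT1_eq E) erefl).
Qed.

(** Projected to endpoints, the equation at identity arrows forces [F] to be
    the identity on objects; after that substitution it holds without casts,
    by uniqueness of identity proofs. *)
Lemma functor_idP (C : category) (F : functor C C) :
  (forall (x y : C) (u : hom x y), total_hom (fhom F u) = total_hom u) ->
  F = functor_id C.
Proof.
case: F => F0 F1 F11 F1M /= FE.
have F0E : F0 = id.
  by apply/funext => x; have /(congr1 (fun s => (projT1 s).1)) := FE x x (idc x).
subst F0.
have F1E : F1 = fun x y u => u.
  apply/functional_extensionality_dep => x.
  apply/functional_extensionality_dep => y.
  apply/functional_extensionality_dep => u.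
  exact/total_hom_inj/FE.
subst F1; rewrite /functor_id.
by congr Functor; apply: Prop_irrelevance.
Qed.

Section FullSubcategory.
Variables (C : category) (P : C -> Prop).
Let CP := category_of_subcategory (full_subcategory P).

Definition full_inclusion : functor CP C :=
  @Functor CP C (fun x => sval x) (fun x y u => sval u)
    (fun x => erefl) (fun x y z v u => erefl).

(** Membership in a full subcategory is a proposition, so equality of arrows
    can be checked in the ambient category. *)
Lemma total_hom_full (x y x' y' : CP) (u : hom x y) (u' : hom x' y') :
  total_hom (sval u) = total_hom (sval u') -> total_hom u = total_hom u'.
Proof.
case: x y x' y' u u' => [x px] [y py] [x' px'] [y' py'] [u pu] [u' pu'] /= E.
have Ex : x = x' by have := congr1 (fun s => (projT1 s).1) E.
have Ey : y = y' by have := congr1 (fun s => (projT1 s).2) E.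
subst x' y'.
move/total_hom_inj: E => Eu; subst u'.
rewrite (Prop_irrelevance px' px) (Prop_irrelevance py' py) in pu' *.
by rewrite (Prop_irrelevance pu' pu).
Qed.

Variables (D : category) (F : functor D C) (PF : forall x, P (F x)).

Definition corestrict_hom (x y : D) (u : hom x y) :
  @hom CP (exist _ (F x) (PF x)) (exist _ (F y) (PF y)) :=
  exist _ (fhom F u) (conj (PF x) (PF y)).

Lemma corestrict1 x : corestrict_hom (idc x) = idc _.
Proof. by apply: eq_exist; rewrite fhom1. Qed.

Lemma corestrictM x y z (v : hom y z) (u : hom x y) :
  corestrict_hom (compc v u) = compc (corestrict_hom v) (corestrict_hom u).
Proof. by apply: eq_exist; rewrite fhomM. Qed.

Definition corestrict : functor D CP := Functor corestrict1 corestrictM.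

End FullSubcategory.

Section QuotientFunctor.
Variables (P Q : precategory) (F0 : pob P -> pob Q).
Variable F1 : forall x y, phom x y -> phom (F0 x) (F0 y).
Hypothesis F1_eq : forall x y (u v : phom x y), peq u v -> peq (F1 u) (F1 v).
Hypothesis F1_id : forall x, F1 (pid x) = pid (F0 x).
Hypothesis F1_comp : forall x y z (v : phom y z) (u : phom x y),
  F1 (pcomp v u) = pcomp (F1 v) (F1 u).

Definition quotient_hom x y (A : qhom x y) : qhom (F0 x) (F0 y) :=
  qclass (F1 (qrepr A)).

Lemma quotient_hom_class x y (u : phom x y) :
  quotient_hom (qclass u) = qclass (F1 u).
Proof. exact/qclassP/F1_eq/qrepr_class. Qed.

Lemma quotient_hom1 x : quotient_hom (qid x) = qid (F0 x).
Proof. by rewrite quotient_hom_class F1_id. Qed.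

Lemma quotient_homM x y z (B : qhom y z) (A : qhom x y) :
  quotient_hom (qcomp B A) = qcomp (quotient_hom B) (quotient_hom A).
Proof.
rewrite -(qreprK A) -(qreprK B).
by rewrite qcompE !quotient_hom_class qcompE F1_comp.
Qed.

Definition quotient_functor :
  functor (quotient_category P) (quotient_category Q) :=
  @Functor (quotient_category P) (quotient_category Q)
    F0 quotient_hom quotient_hom1 quotient_homM.

End QuotientFunctor.

Lemma total_hom_qclass (P : precategory) (x y x' y' : pob P)
    (u : phom x y) (u' : phom x' y') :
  existT (fun p => phom p.1 p.2) (x, y) u =
  existT (fun p => phom p.1 p.2) (x', y') u' ->
  @total_hom (quotient_category P) x y (qclass u) =
  @total_hom (quotient_category P) x' y' (qclass u').
Proof.
exact: (congr1 (fun s : {p : pob P * pob P & phom p.1 p.2} =>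
  @total_hom (quotient_category P) _ _ (qclass (projT2 s)))).
Qed.

(** When objects are well-formed raw terms and arrows are typed raw arrow
    terms, as in both presentations, an arrow with its endpoints is determined
    by the raw data. *)
Lemma total_arr_eq (T A : Type) (W : T -> Prop) (R : A -> T -> T -> Prop)
    (x y x' y' : {t | W t})
    (u : {a | R a (sval x) (sval y)}) (u' : {a | R a (sval x') (sval y')}) :
  sval x = sval x' -> sval y = sval y' -> sval u = sval u' ->
  existT (fun p : {t | W t} * {t | W t} =>
    {a | R a (sval p.1) (sval p.2)}) (x, y) u = existT _ (x', y') u'.
Proof.
case: x y x' y' u u' => [x wx] [y wy] [x' wx'] [y' wy'] [u Ru] [u' Ru'] /=.
move=> ex ey eu; subst x' y' u'.
move: Ru'; rewrite (Prop_irrelevance wx' wx) (Prop_irrelevance wy' wy) => Ru'.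
by rewrite (Prop_irrelevance Ru' Ru).
Qed.

(** * Words *)

(** The address of [w] relative to [a]; meaningful when [a] is a prefix of
    [w]. *)
Definition after (a w : word) : word := drop (size a) w.
(** [a] is a prefix of [w], in the form of the equation by which absolute
    addresses are recovered from relative ones. *)
Definition extends (a w : word) : Prop := a ++ after a w = w.

Lemma after_cat a w : after a (a ++ w) = w.
Proof. exact: drop_size_cat. Qed.

Lemma afterxx a : after a a = [::].
Proof. exact: drop_size. Qed.

Lemma extends_cat a w : extends a (a ++ w).
Proof. by rewrite /extends after_cat. Qed.

(** Relative addresses compose by concatenation: this matches the index
    [b ++ a] of beta in [WOe] with the absolute address of the innermost
    term in [WOu]. *)
Lemma after_trans a b c : extends a b -> extends b c ->
  after a b ++ after b c = after a c.
Proof. by move=> ab bc; rewrite -[LHS](after_cat a) catA ab bc. Qed.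

Lemma in_cat_set a (X : set word) w : cat_set a X (a ++ w) <-> X w.
Proof.
split; last by move=> Xw; exists w.
by move=> [v Xv vw]; rewrite -(after_cat a w) -vw after_cat.
Qed.

Lemma cat_set_insert a b (X Y : set word) :
  cat_set a (insert_set Y b X) =
  insert_set (cat_set a Y) (a ++ b) (cat_set a X).
Proof.
rewrite /insert_set; apply/seteqP; split=> w.
  case=> v [[Yv vb]|Xv] <-; last by right; exists v.
  left; split; first by exists v.
  by move=> /= /(congr1 (after a)); rewrite !after_cat.
case=> [[[v Yv <-] vb]|[v Xv <-]]; exists v => //; last by right.
by left; split=> // vE; apply: vb; rewrite /= vE.
Qed.

Lemma cat_set_cat a b (X : set word) :
  cat_set (a ++ b) X = cat_set a (cat_set b X).
Proof.
apply/seteqP; split=> w.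
  by case=> v Xv <-; exists (b ++ v); [exists v|rewrite catA].
by case=> _ [v Xv <-] <-; exists v; rewrite ?catA.
Qed.

Section Translation.
Variables (G : Type) (alpha : G -> nat).

(** * Terms *)

Fixpoint place (b : word) (f : WOe.term G) : WOu.term G :=
  match f with
  | WOe.Gen x => WOu.Gen b x
  | WOe.Unit => WOu.Unit G b
  | WOe.Ins g a f => WOu.Ins (place b g) (place (b ++ a) f)
  end.

Fixpoint unplace (f : WOu.term G) : WOe.term G :=
  match f with
  | WOu.Gen _ x => WOe.Gen x
  | WOu.Unit _ => WOe.Unit G
  | WOu.Ins g f =>
      WOe.Ins (unplace g) (after (WOu.t g) (WOu.t f)) (unplace f)
  end.

Lemma t_place b f : WOu.t (place b f) = b.
Proof. by elim: f b => //= g IHg a f _ b. Qed.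

Lemma placeK b f : unplace (place b f) = f.
Proof.
by elim: f b => //= g IHg a f IHf b; rewrite IHg IHf !t_place after_cat.
Qed.

Lemma s_place b f : WOu.s alpha (place b f) = cat_set b (WOe.s alpha f).
Proof.
have s1 c : [set c] = cat_set c [set [::]] :> set word.
  by rewrite /cat_set image_set1 cats0.
elim: f b => [x||g IHg a f IHf] b /=; [by case: ifP|by []|].
by rewrite IHg IHf t_place cat_set_insert cat_set_cat.
Qed.

Lemma in_s_place b f a :
  WOu.s alpha (place b f) (b ++ a) <-> WOe.s alpha f a.
Proof. by rewrite s_place in_cat_set. Qed.

Lemma wf_place b f : WOe.wf alpha f -> WOu.wf alpha (place b f).
Proof.
elim: f b => //= g IHg a f IHf b [wg wf ga]; split; rewrite ?t_place.
- exact: IHg.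
- exact: IHf.
- exact/in_s_place.
Qed.

(** The first hypothesis is the induction hypothesis of [unplace_wfK], so that
    the membership facts are available inside that induction. *)
Lemma in_s_unplace f w : place (WOu.t f) (unplace f) = f ->
  WOu.s alpha f w ->
  extends (WOu.t f) w /\ WOe.s alpha (unplace f) (after (WOu.t f) w).
Proof.
move=> fE; rewrite -{1}fE s_place => -[v fv <-].
by rewrite after_cat; split; first exact: extends_cat.
Qed.

(** The two conclusions need each other: [f] is inserted in [g] at a word of
    [s g], and [place (t g) (unplace g) = g] turns that word into [t g]
    followed by a word of [s (unplace g)]; this makes the insertion legal in
    [WOe] and shows that no address is lost. *)
Lemma unplace_wfK f : WOu.wf alpha f ->
  WOe.wf alpha (unplace f) /\ place (WOu.t f) (unplace f) = f.
Proof.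
elim: f => //= g IHg f IHf [/IHg[wg gE] /IHf[wf fE] gf].
have [tgf sgf] := in_s_unplace gE gf.
by split; rewrite ?tgf ?gE ?fE.
Qed.

Lemma wf_unplace f : WOu.wf alpha f -> WOe.wf alpha (unplace f).
Proof. by case/unplace_wfK. Qed.

Lemma unplaceK f : WOu.wf alpha f -> place (WOu.t f) (unplace f) = f.
Proof. by case/unplace_wfK. Qed.

Lemma wf_extends f w : WOu.wf alpha f -> WOu.s alpha f w ->
  extends (WOu.t f) w.
Proof. by move=> /unplaceK fE /(in_s_unplace fE)[]. Qed.

Lemma s_unplace f w : WOu.wf alpha f -> WOu.s alpha f w ->
  WOe.s alpha (unplace f) (after (WOu.t f) w).
Proof. by move=> /unplaceK fE /(in_s_unplace fE)[]. Qed.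

(** * Arrow terms *)

Fixpoint place_arr (b : word) (u : WOe.arr G) : WOu.arr G :=
  match u with
  | WOe.One f => WOu.One (place b f)
  | WOe.Beta h c g a f =>
      WOu.Beta (place b h) (place (b ++ c) g) (place (b ++ c ++ a) f)
  | WOe.BetaV h c g a f =>
      WOu.BetaV (place b h) (place (b ++ c) g) (place (b ++ c ++ a) f)
  | WOe.Theta h c g a f =>
      WOu.Theta (place b h) (place (b ++ c) g) (place (b ++ a) f)
  | WOe.Mu f a => WOu.Mu (place b f) (b ++ a)
  | WOe.MuV f a => WOu.MuV (place b f) (b ++ a)
  | WOe.Lam f => WOu.Lam (place b f)
  | WOe.LamV f => WOu.LamV (place b f)
  | WOe.Comp v u => WOu.Comp (place_arr b v) (place_arr b u)
  | WOe.AIns v a u => WOu.AIns (place_arr b v) (place_arr (b ++ a) u)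
  end.

(** The common root word of source and target, read off the raw arrow term
    so that [unplace_arr] needs no typing derivation. *)
Fixpoint root (u : WOu.arr G) : word :=
  match u with
  | WOu.One f | WOu.Mu f _ | WOu.MuV f _ | WOu.Lam f | WOu.LamV f => WOu.t f
  | WOu.Beta h _ _ | WOu.BetaV h _ _ | WOu.Theta h _ _ => WOu.t h
  | WOu.Comp _ u => root u
  | WOu.AIns v _ => root v
  end.

Fixpoint unplace_arr (u : WOu.arr G) : WOe.arr G :=
  match u with
  | WOu.One f => WOe.One (unplace f)
  | WOu.Beta h g f =>
      WOe.Beta (unplace h) (after (WOu.t h) (WOu.t g)) (unplace g)
        (after (WOu.t g) (WOu.t f)) (unplace f)
  | WOu.BetaV h g f =>
      WOe.BetaV (unplace h) (after (WOu.t h) (WOu.t g)) (unplace g)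
        (after (WOu.t g) (WOu.t f)) (unplace f)
  | WOu.Theta h g f =>
      WOe.Theta (unplace h) (after (WOu.t h) (WOu.t g)) (unplace g)
        (after (WOu.t h) (WOu.t f)) (unplace f)
  | WOu.Mu f a => WOe.Mu (unplace f) (after (WOu.t f) a)
  | WOu.MuV f a => WOe.MuV (unplace f) (after (WOu.t f) a)
  | WOu.Lam f => WOe.Lam (unplace f)
  | WOu.LamV f => WOe.LamV (unplace f)
  | WOu.Comp v u => WOe.Comp (unplace_arr v) (unplace_arr u)
  | WOu.AIns v u =>
      WOe.AIns (unplace_arr v) (after (root v) (root u)) (unplace_arr u)
  end.

Lemma root_place b u : root (place_arr b u) = b.
Proof. by elim: u b => //= *; rewrite t_place. Qed.

Lemma place_arrK b u : unplace_arr (place_arr b u) = u.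
Proof.
elim: u b => //= *; rewrite ?placeK ?t_place ?root_place ?after_cat //.
- by rewrite catA after_cat.
- by rewrite catA after_cat.
- by congr WOe.Comp.
- by congr WOe.AIns.
Qed.

(** The part of well-typedness that concerns addresses: the prefix conditions
    which legitimize beta, and the agreement of roots in a composite.  Unlike
    typing, it is computed by recursion on the raw arrow term, so for each
    generating equation it unfolds to the conditions that the translated
    equation uses. *)
Fixpoint coherent (u : WOu.arr G) : Prop :=
  match u with
  | WOu.Beta h g f | WOu.BetaV h g f =>
      extends (WOu.t h) (WOu.t g) /\ extends (WOu.t g) (WOu.t f)
  | WOu.Comp v u => [/\ coherent v, coherent u & root v = root u]
  | WOu.AIns v u => coherent v /\ coherent u
  | _ => True
  end.

Lemma typed_root u f g : WOu.typed alpha u f g ->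
  root u = WOu.t f /\ root u = WOu.t g.
Proof.
elim=> //= {u f g} u v f g h _ [uf ug] _ [vg vh].
by rewrite uf -uf ug -vg.
Qed.

Lemma typed_coherent u f g : WOu.typed alpha u f g -> coherent u.
Proof.
elim=> //= {u f g}.
- by move=> h g f wh wg _ hg gf; split; [exact: wf_extends hg|exact: wf_extends gf].
- by move=> h g f wh wg _ hg gf; split; [exact: wf_extends hg|exact: wf_extends gf].
- move=> u v f g h /typed_root[_ ug] cu /typed_root[vg _] cv.
  by split=> //; rewrite ug vg.
Qed.

Lemma typed_place b u f g : WOe.typed alpha u f g ->
  WOu.typed alpha (place_arr b u) (place b f) (place b g).
Proof.
move=> uT; elim: uT b => {u f g} /=.
- by move=> f wf b; constructor; exact: wf_place.
- move=> h c g a f wh wg wf hc ga b.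
  rewrite catA; constructor; rewrite ?t_place; try exact: wf_place.
  + exact/in_s_place.
  + exact/in_s_place.
- move=> h c g a f wh wg wf hc ga b.
  rewrite catA; constructor; rewrite ?t_place; try exact: wf_place.
  + exact/in_s_place.
  + exact/in_s_place.
- move=> h c g a f wh wg wf ha hc ac b.
  constructor; rewrite ?t_place; try exact: wf_place; try by apply/in_s_place.
  by move=> /(congr1 (after b)); rewrite !after_cat => ca; apply: ac.
- by move=> f a wf fa b; constructor; [exact: wf_place|exact/in_s_place].
- by move=> f a wf fa b; constructor; [exact: wf_place|exact/in_s_place].
- move=> f wf b; rewrite cats0 -{2}(t_place b f).
  by constructor; exact: wf_place.
- move=> f wf b; rewrite cats0 -{3}(t_place b f).
  by constructor; exact: wf_place.
- move=> u v f g h _ IHu _ IHv b; exact: WOu.typed_Comp (IHu b) (IHv b).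
- move=> u v a f f' g g' _ IHu _ IHv w w' b.
  apply: WOu.typed_Ins => //.
  + exact: (@wf_place b (WOe.Ins g a f)).
  + exact: (@wf_place b (WOe.Ins g' a f')).
Qed.

Lemma typed_unplace u f g : WOu.typed alpha u f g ->
  WOe.typed alpha (unplace_arr u) (unplace f) (unplace g).
Proof.
elim=> {u f g} /=.
- by move=> f wf; constructor; exact: wf_unplace.
- move=> h g f wh wg wf hg gf.
  rewrite -(after_trans (wf_extends wh hg) (wf_extends wg gf)).
  by constructor; try exact: wf_unplace; exact: s_unplace.
- move=> h g f wh wg wf hg gf.
  rewrite -(after_trans (wf_extends wh hg) (wf_extends wg gf)).
  by constructor; try exact: wf_unplace; exact: s_unplace.
- move=> h g f wh wg wf hg hf gf.
  constructor; try exact: wf_unplace; try exact: s_unplace.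
  move=> E; apply: gf.
  by rewrite -(wf_extends wh hg) -(wf_extends wh hf) E.
- by move=> f a wf fa; constructor; [exact: wf_unplace|exact: s_unplace].
- by move=> f a wf fa; constructor; [exact: wf_unplace|exact: s_unplace].
- by move=> f wf; rewrite afterxx; constructor; exact: wf_unplace.
- by move=> f wf; rewrite afterxx; constructor; exact: wf_unplace.
- by move=> u v f g h _ IHu _ IHv; exact: WOe.typed_Comp IHu IHv.
- move=> u v f f' g g' uT IHu vT IHv wgf wgf'.
  have [uf uf'] := typed_root uT; have [vg vg'] := typed_root vT.
  have := @wf_unplace (WOu.Ins g' f') wgf'.
  have := @wf_unplace (WOu.Ins g f) wgf.
  rewrite /= -uf -uf' -vg -vg' => w w'.
  exact: WOe.typed_Ins.
Qed.

Lemma unplace_arrK u f g : WOu.typed alpha u f g ->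
  place_arr (WOu.t f) (unplace_arr u) = u.
Proof.
elim=> {u f g} /=.
- by move=> f wf; rewrite unplaceK.
- move=> h g f wh wg wf hg gf.
  by rewrite catA (wf_extends wh hg) (wf_extends wg gf) !unplaceK.
- move=> h g f wh wg wf hg gf.
  by rewrite catA (wf_extends wh hg) (wf_extends wg gf) !unplaceK.
- move=> h g f wh wg wf hg hf _.
  by rewrite (wf_extends wh hg) (wf_extends wh hf) !unplaceK.
- by move=> f a wf fa; rewrite (wf_extends wf fa) unplaceK.
- by move=> f a wf fa; rewrite (wf_extends wf fa) unplaceK.
- by move=> f wf; rewrite unplaceK.
- by move=> f wf; rewrite unplaceK.
- move=> u v f g h /typed_root[uf ug] IHu _ IHv.
  by rewrite IHu -uf ug IHv.
- move=> u v f f' g g' /typed_root[uf _] IHu /typed_root[vg _] IHv [wg _ gf] _.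
  by rewrite uf vg (wf_extends wg gf) IHu IHv.
Qed.

(** * Generating equations and the congruence *)

Lemma ax_place b u v : WOe.ax alpha u v ->
  WOu.ax alpha (place_arr b u) (place_arr b v).
Proof.
case=> {u v} /=.
all: try by intros; rewrite -?catA ?cats0; econstructor; eauto;
  apply: typed_place; eassumption.
(* The equations about lambda and the empty word remain: in [WOu] they mention
   the root word of a term, which is [b] only by [t_place]. *)
- move=> u f1 f2 /(typed_place b)/WOu.ax_Lam_nat.
  by rewrite t_place cats0.
- by move=> f; have := WOu.ax_LamK alpha (place b f); rewrite t_place cats0.
- move=> h c f; have := WOu.ax_BetaUnit alpha (place b h) (place (b ++ c) f).
  by rewrite t_place cats0.
Qed.

(** Coherence is needed because the equations of [WOu] involve arbitrary raw
    terms: without the prefix conditions, the address of [f] relative to [h]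
    would not be the concatenation of its steps through [g]. *)
Lemma ax_unplace u v : coherent u -> coherent v -> WOu.ax alpha u v ->
  WOe.ax alpha (unplace_arr u) (unplace_arr v).
Proof.
move=> cu cv uv; case: uv cu cv => {u v} /=.
all: try by intros; econstructor; eauto; apply: typed_unplace; eassumption.
- move=> v1 v2 u1 u2 [[_ _ v12] [_ _ u12]] _; rewrite v12 u12.
  exact: WOe.ax_ins_comp.
- move=> u v w f1 f2 g1 g2 h1 h2 uT vT wT [[hg gf] _ _] _.
  have [u1 u2] := typed_root uT; have [v1 v2] := typed_root vT.
  have [w1 w2] := typed_root wT.
  rewrite -u1 -v1 -w1 -u2 -v2 -w2 in hg gf *.
  rewrite -(after_trans hg gf).
  by apply: WOe.ax_Beta_nat; exact: typed_unplace.
- move=> u v w f1 f2 g1 g2 h1 h2 uT vT wT _ _.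
  have [u1 u2] := typed_root uT; have [v1 v2] := typed_root vT.
  have [w1 w2] := typed_root wT.
  rewrite -u1 -v1 -w1 -u2 -v2 -w2.
  by apply: WOe.ax_Theta_nat; exact: typed_unplace.
- move=> h g f [[hg gf] _ _] _; rewrite -(after_trans hg gf).
  exact: WOe.ax_BetaK.
- move=> j h g f [[[_ [hg gf]] [jh hf] _] _ _] _.
  rewrite -(after_trans jh hf) -(after_trans hg gf) -(after_trans jh hg).
  exact: WOe.ax_BetaBeta.
- move=> j h g f [[_ [jh hf] _] [[_ hg] _] _] _.
  rewrite -(after_trans jh hf) -(after_trans jh hg).
  exact: WOe.ax_BetaTheta1.
- move=> j h g f [_ [[jh hg] _] _] _; rewrite -(after_trans jh hg).
  exact: WOe.ax_BetaTheta2.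
- move=> u f1 f2 a uT [_ _ ->] [_ _ <-].
  exact/WOe.ax_Mu_nat/typed_unplace.
- move=> u f1 f2 uT _ [_ _ <-]; rewrite afterxx.
  exact/WOe.ax_Lam_nat/typed_unplace.
- by move=> f _ _; rewrite afterxx; exact: WOe.ax_LamK.
- by move=> h f _ _; rewrite afterxx; exact: WOe.ax_BetaUnit.
Qed.

Lemma eqv_typed f g u v : WOu.eqv alpha f g u v ->
  WOu.typed alpha u f g /\ WOu.typed alpha v f g.
Proof.
elim=> {f g u v} //.
- by move=> f g u v _ [].
- by move=> f g u v w _ [uT _] _ [].
- move=> f g h u u' v v' _ [uT uT'] _ [vT vT'].
  by split; [exact: WOu.typed_Comp uT vT|exact: WOu.typed_Comp uT' vT'].
- move=> f f' g g' u u' v v' _ [uT uT'] _ [vT vT'] w w'.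
  by split; apply: WOu.typed_Ins.
Qed.

Lemma eqv_place b f g u v : WOe.eqv alpha f g u v ->
  WOu.eqv alpha (place b f) (place b g) (place_arr b u) (place_arr b v).
Proof.
move=> uv; elim: uv b => {f g u v} /=.
- move=> f g u v uv uT vT b.
  by apply: WOu.eqv_ax; [exact: ax_place|exact: typed_place|exact: typed_place].
- by move=> f g u uT b; apply/WOu.eqv_refl/typed_place.
- by move=> f g u v _ IH b; apply: WOu.eqv_sym.
- by move=> f g u v w _ uv _ vw b; apply: WOu.eqv_trans (uv b) (vw b).
- by move=> f g h u u' v v' _ IHu _ IHv b; apply: WOu.eqv_Comp (IHu b) (IHv b).
- move=> a f f' g g' u u' v v' _ IHu _ IHv w w' b.
  apply: WOu.eqv_Ins => //.
  + exact: (@wf_place b (WOe.Ins g a f)).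
  + exact: (@wf_place b (WOe.Ins g' a f')).
Qed.

Lemma eqv_unplace f g u v : WOu.eqv alpha f g u v ->
  WOe.eqv alpha (unplace f) (unplace g) (unplace_arr u) (unplace_arr v).
Proof.
elim=> {f g u v} /=.
- move=> f g u v uv uT vT; apply: WOe.eqv_ax.
  + exact: ax_unplace (typed_coherent uT) (typed_coherent vT) uv.
  + exact: typed_unplace.
  + exact: typed_unplace.
- by move=> f g u uT; apply/WOe.eqv_refl/typed_unplace.
- by move=> f g u v _; apply: WOe.eqv_sym.
- by move=> f g u v w _ uv _; apply: WOe.eqv_trans uv.
- by move=> f g h u u' v v' _ IHu _; apply: WOe.eqv_Comp IHu.
- move=> f f' g g' u u' v v' uE IHu vE IHv wgf wgf'.
  have [/typed_root[uf uf'] /typed_root[uf2 _]] := eqv_typed uE.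
  have [/typed_root[vg vg'] /typed_root[vg2 _]] := eqv_typed vE.
  have := @wf_unplace (WOu.Ins g' f') wgf'.
  have := @wf_unplace (WOu.Ins g f) wgf.
  rewrite /= uf2 vg2 -uf' -vg' uf vg => w w'.
  exact: WOe.eqv_Ins.
Qed.

(** * The two functors *)

Definition place_Ob (b : word) (f : WOe.Ob alpha) : WOu.Ob alpha :=
  exist _ (place b (sval f)) (wf_place b (svalP f)).

Definition place_Arr (b : word) (f g : WOe.Ob alpha) (u : WOe.Arr f g) :
  WOu.Arr (place_Ob b f) (place_Ob b g) :=
  exist _ (place_arr b (sval u)) (typed_place b (svalP u)).

Definition unplace_Ob (f : WOu.Ob alpha) : WOe.Ob alpha :=
  exist _ (unplace (sval f)) (wf_unplace (svalP f)).

Definition unplace_Arr (f g : WOu.Ob alpha) (u : WOu.Arr f g) :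
  WOe.Arr (unplace_Ob f) (unplace_Ob g) :=
  exist _ (unplace_arr (sval u)) (typed_unplace (svalP u)).

Lemma place_Arr_eq b (f g : WOe.Ob alpha) (u v : WOe.Arr f g) :
  WOe.eq_Arr u v -> WOu.eq_Arr (place_Arr b u) (place_Arr b v).
Proof. exact: eqv_place. Qed.

Lemma unplace_Arr_eq (f g : WOu.Ob alpha) (u v : WOu.Arr f g) :
  WOu.eq_Arr u v -> WOe.eq_Arr (unplace_Arr u) (unplace_Arr v).
Proof. exact: eqv_unplace. Qed.

Lemma place_Arr1 b (f : WOe.Ob alpha) :
  place_Arr b (WOe.id_Arr f) = WOu.id_Arr (place_Ob b f).
Proof. exact: eq_exist. Qed.

Lemma place_ArrM b (f g h : WOe.Ob alpha) (v : WOe.Arr g h) (u : WOe.Arr f g) :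
  place_Arr b (WOe.comp_Arr v u) =
  WOu.comp_Arr (place_Arr b v) (place_Arr b u).
Proof. exact: eq_exist. Qed.

Lemma unplace_Arr1 (f : WOu.Ob alpha) :
  unplace_Arr (WOu.id_Arr f) = WOe.id_Arr (unplace_Ob f).
Proof. exact: eq_exist. Qed.

Lemma unplace_ArrM (f g h : WOu.Ob alpha)
  (v : WOu.Arr g h) (u : WOu.Arr f g) :
  unplace_Arr (WOu.comp_Arr v u) =
  WOe.comp_Arr (unplace_Arr v) (unplace_Arr u).
Proof. exact: eq_exist. Qed.

Definition place_functor (b : word) : functor (WOe.cat alpha) (WOu.cat alpha) :=
  @quotient_functor (WOe.presentation alpha) (WOu.presentation alpha)
    (place_Ob b) (@place_Arr b) (@place_Arr_eq b)
    (place_Arr1 b) (@place_ArrM b).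

Definition unplace_functor : functor (WOu.cat alpha) (WOe.cat alpha) :=
  @quotient_functor (WOu.presentation alpha) (WOe.presentation alpha)
    unplace_Ob unplace_Arr unplace_Arr_eq
    unplace_Arr1 unplace_ArrM.

Lemma place_functor_class b (f g : WOe.Ob alpha) (u : WOe.Arr f g) :
  @fhom _ _ (place_functor b) f g (@qclass (WOe.presentation alpha) f g u) =
  @qclass (WOu.presentation alpha) _ _ (place_Arr b u).
Proof.
exact: (@quotient_hom_class (WOe.presentation alpha) (WOu.presentation alpha)
  _ _ (@place_Arr_eq b)).
Qed.

Lemma unplace_functor_class (f g : WOu.Ob alpha) (u : WOu.Arr f g) :
  @fhom _ _ unplace_functor f g (@qclass (WOu.presentation alpha) f g u) =
  @qclass (WOe.presentation alpha) _ _ (unplace_Arr u).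
Proof.
exact: (@quotient_hom_class (WOu.presentation alpha) (WOe.presentation alpha)
  _ _ unplace_Arr_eq).
Qed.

Lemma place_functorK b (f g : WOe.cat alpha) (A : hom f g) :
  total_hom (fhom unplace_functor (fhom (place_functor b) A)) = total_hom A.
Proof.
rewrite -(qreprK A).
apply: (etrans (congr1 (@total_hom (WOe.cat alpha) _ _)
  (etrans (congr1 (@fhom _ _ unplace_functor _ _)
    (place_functor_class b (qrepr A))) (unplace_functor_class _)))).
apply: (@total_hom_qclass (WOe.presentation alpha)).
by apply: total_arr_eq; rewrite /= ?placeK ?place_arrK.
Qed.

Lemma unplace_functorK b (f g : WOu.cat alpha) (A : hom f g) :
  WOu.t (sval f) = b -> WOu.t (sval g) = b ->
  total_hom (fhom (place_functor b) (fhom unplace_functor A)) = total_hom A.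
Proof.
move=> fb gb; rewrite -(qreprK A).
apply: (etrans (congr1 (@total_hom (WOu.cat alpha) _ _)
  (etrans (congr1 (@fhom _ _ (place_functor b) _ _)
    (unplace_functor_class (qrepr A))) (place_functor_class b _)))).
apply: (@total_hom_qclass (WOu.presentation alpha)).
apply: total_arr_eq => /=.
- by rewrite -fb unplaceK //; exact: svalP f.
- by rewrite -gb unplaceK //; exact: svalP g.
- by rewrite -fb (unplace_arrK (svalP (qrepr A))).
Qed.

Lemma hom_t (f g : WOu.cat alpha) (A : hom f g) :
  WOu.t (sval f) = WOu.t (sval g).
Proof. by have [<-] := typed_root (svalP (qrepr A)). Qed.

Lemma cat_at_disjoint :
  disjoint_union_of_subcategories (fun b : word => WOu.cat_at alpha b).
Proof.
split=> [f|f g A]; exists (WOu.t (sval f)); split=> //=.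
- by rewrite (hom_t A).
- by move=> b [].
Qed.

(** The composite at an object [f] places [unplace f] back at [b], so it is the
    identity exactly where [t f = b]. *)
Lemma cat_at_isomorphic b :
  isomorphic (category_of_subcategory (WOu.cat_at alpha b)) (WOe.cat alpha).
Proof.
pose at_b (f : WOu.cat alpha) := WOu.t (sval f) = b.
exists (functor_comp unplace_functor (full_inclusion at_b)).
exists (corestrict (P := at_b) (F := place_functor b)
  (fun f => t_place b (sval f))).
split; apply: functor_idP => f g A; last exact: place_functorK.
by apply/total_hom_full/unplace_functorK; [exact: svalP f|exact: svalP g].
Qed.

End Translation.

Theorem mainTheorem3 (G : Type) (alpha : G -> nat) :
  disjoint_union_of_subcategories (fun b : word => WOu.cat_at alpha b) /\
  (forall b : word,
     isomorphic (category_of_subcategory (WOu.cat_at alpha b)) (WOe.cat alpha)).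
Proof. by split; [exact: cat_at_disjoint|exact: cat_at_isomorphic]. Qed.
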